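(* Let $X,Z$ be compact metric spaces with a uniformly contractive iterated function system $\{\tau_x:Z\to Z\}_{x\in X}$, let $\alpha\in\mathcal{P}(X)$ have full support, and let $\mu\in\mathcal{P}(X)$. For every continuous $c:X\times Z\to\mathbb{R}$, $$\inf_{P_\alpha(c-\varphi(x))=0}\int\varphi\,d\mu=\sup_{\pi\in\Pi(\mu,\tau)}\int c\,d\pi+H_\alpha(\pi),$$ where the infimum is over all $\varphi\in C(X)$ such that the pressure of $(x,z)\mapsto c(x,z)-\varphi(x)$ equals $0$.
   Context: $\mathcal{P}(S)$ is the set of Borel probability measures on a compact metric space $S$, and $C(S)$ the space of continuous real functions on $S$. Uniformly contractive means: there is a constant $0<\gamma<1$ with $d(\tau_{x_1}(z_1),\tau_{x_2}(z_2))\le\gamma[d(x_1,x_2)+d(z_1,z_2)]$ for all $x_i\in X$, $z_i\in Z$. Lipschitz on $X\times Z$ refers to the metric $d(x_1,x_2)+d(z_1,z_2)$. $\Pi(\tau)$ is the set of holonomic probabilities: those $\pi\in\mathcal{P}(X\times Z)$ with $\int g(\tau_x(z))\,d\pi(x,z)=\int g(z)\,d\pi(x,z)$ for all $g\in C(Z)$. $\Pi(\mu,\tau)$ is the set of $\pi\in\Pi(\tau)$ with $X$-marginal $\mu$. For Lipschitz $b:X\times Z\to\mathbb{R}$, $L_{b,\alpha}(u)(z)=\int e^{b(x,z)}u(\tau_x(z))\,d\alpha(x)$ for $u\in C(Z)$. For $\pi\in\Pi(\tau)$, $$H_\alpha(\pi)=-\sup\Big\{\int b\,d\pi \;:\;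 b\text{ Lipschitz},\ L_{b,\alpha}(1)=1\Big\}\in[-\infty,0],$$ and for continuous $k:X\times Z\to\mathbb{R}$, $P_\alpha(k)=\sup_{\pi\in\Pi(\tau)}\big[\int k\,d\pi+H_\alpha(\pi)\big]$. Equalities are in the extended reals (values $-\infty$ allowed). *)

(* Defs.v *)
From HB Require Import structures.
From mathcomp Require Import all_boot all_order all_algebra.
From mathcomp Require Import all_classical all_reals all_analysis.
Import Order.TTheory GRing.Theory Num.Theory.
Import numFieldNormedType.Exports.

Set Implicit Arguments.
Unset Strict Implicit.
Unset Printing Implicit Defensive.

Local Open Scope classical_set_scope.
Local Open Scope ring_scope.
Local Open Scope ereal_scope.

(* Measurable types are pointed in MathComp-Analysis, metric types are not;
   the join is the type of nonempty metric spaces. *)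
#[short(type="pmetricType")]
HB.structure Definition PMetric (R : numDomainType) :=
  {M of Pointed M & Metric R M}.

Notation borel T := (g_sigma_algebraType (@open T)).

(* On [X * Z] this is the Borel sigma-algebra of the product topology. *)
Notation borel_probability T R := (probability (borel T) R).

Section ifs.
Context {R : realType} {X Z : pmetricType R}.
Implicit Types (tau : X -> Z -> Z) (b k : X * Z -> R).
Implicit Types (alpha mu : borel_probability X R).
Implicit Types (pi : borel_probability (X * Z)%type R).

Definition full_support alpha : Prop :=
  forall U : set X, open U -> U !=set0 -> 0 < alpha U.

(* The library metric on [X * Z] is the maximum; the sum metric used here is
   therefore written out. *)
Definition dist_sum (p q : X * Z) : R := (mdist p.1 q.1 + mdist p.2 q.2)%R.

Definition uniformly_contractive tau : Prop :=
  exists2 gamma : R, (0 < gamma < 1)%R &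
    forall p q : X * Z,
      (mdist (tau p.1 p.2) (tau q.1 q.2) <= gamma * dist_sum p q)%R.

Definition is_lipschitz b : Prop :=
  exists K : R, forall p q : X * Z, (`|b p - b q| <= K * dist_sum p q)%R.

Definition holonomic tau : set (borel_probability (X * Z)%type R) :=
  [set pi : borel_probability (X * Z)%type R | forall g : Z -> R, continuous g ->
     \int[pi]_p (g (tau p.1 p.2))%:E = \int[pi]_p (g p.2)%:E].

Definition has_Xmarginal mu pi : Prop :=
  forall A : set (borel X), measurable A ->
    pushforward pi (fst : borel (X * Z)%type -> borel X) A = mu A.

Definition holonomic_marginal mu tau : set (borel_probability (X * Z)%type R) :=
  [set pi : borel_probability (X * Z)%type R | holonomic tau pi /\ has_Xmarginal mu pi].

Definition transfer tau alpha b (u : Z -> R) : Z -> R :=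
  fun z => (\int[alpha]_x (expR (b (x, z)) * u (tau x z)))%R.

Definition entropy tau alpha pi : \bar R :=
  - ereal_sup [set \int[pi]_p (b p)%:E |
      b in [set b | is_lipschitz b /\
                    transfer tau alpha b (cst 1%R) = cst 1%R]].

Definition pressure tau alpha k : \bar R :=
  ereal_sup [set \int[pi]_p (k p)%:E + entropy tau alpha pi |
    pi in holonomic tau].

End ifs.

(* Main.v *)
(* Convex duality for the functional [phi |-> P (c - phi) + \int phi dmu], where
   [P] is the pressure. By Hahn-Banach, the affine functional
   [c - phi |-> V - \int phi dmu], with [V] the infimum, which lies below the
   convex functional [P], extends to an affine functional on [C(X * Z)] below
   [P]. Monotonicity of [P], its translation by constants and its invariance
   under [h o tau - h] force the linear part to be positive, normalised and
   holonomic with marginal [mu]; by the Riesz representation theorem it is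
   integration against some [pi]. Since [P b <= 0] for normalised [b], that
   [pi] satisfies [V <= \int c dpi + H pi]. Adding a constant to [phi] turns
   [P (c - phi)] into [0]; this needs [P] finite, that is a holonomic
   probability of nonnegative entropy. One is obtained from the same
   Hahn-Banach and Riesz argument, applied to the sublinear functional
   [f |-> inf_h sup_z \int_x (f + h o tau - h)(x, z) dalpha]; there
   [\int b(x, z) dalpha(x) <= 0] comes from [1 + b <= exp b]. *)
Require Import Defs.
From HB Require Import structures.
From mathcomp Require Import all_boot all_order all_algebra.
From mathcomp Require Import all_classical all_reals all_analysis.
From mathcomp Require Import measurable_realfun ring lra.
Import Order.TTheory GRing.Theory Num.Theory.
Import numFieldNormedType.Exports.

Set Implicit Arguments.
Unset Strict Implicit.
Unset Printing Implicit Defensive.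

Local Open Scope classical_set_scope.
Local Open Scope ring_scope.

(** * Hahn-Banach *)

Section sublinear.
Context {R : realType} {E : lmodType R} (V : set E).

(** A subspace is a predicate on the ambient module, so that continuous functions remain plain
    functions; functionals are total and constrained on [V] only. *)
Definition linear_closed_set := V 0 /\
  forall a f g, V f -> V g -> V (a *: f + g).

Definition sublinear_on (p : E -> R) :=
  (forall f g, V f -> V g -> p (f + g) <= p f + p g) /\
  (forall a f, 0 < a -> V f -> p (a *: f) <= a * p f).

Definition linear_on (L : E -> R) :=
  forall a f g, V f -> V g -> L (a *: f + g) = a * L f + L g.

Hypothesis lV : linear_closed_set.

Lemma lcsD f g : V f -> V g -> V (f + g).
Proof. by move=> Vf Vg; rewrite -(scale1r f); apply: lV.2. Qed.

Lemma lcsZ a f : V f -> V (a *: f).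
Proof. by move=> Vf; rewrite -(addr0 (a *: f)); apply: lV.2 => //; case: lV. Qed.

Lemma lcsN f : V f -> V (- f).
Proof. by move=> Vf; rewrite -scaleN1r; apply: lcsZ. Qed.

(** Homogeneity is assumed only as an inequality for positive factors; the factors [2] and [1/2]
    bound [p 0] from both sides. *)
Lemma sublinear_on0 p : sublinear_on p -> p 0 = 0.
Proof.
move=> [_ pZ].
have V0 : V 0 by case: lV.
have := pZ 2 0 ltac:(lra) V0; have := pZ 2^-1 0 ltac:(lra) V0.
rewrite !scaler0; lra.
Qed.

Lemma sublinear_onN p f : sublinear_on p -> V f -> - p (- f) <= p f.
Proof.
move=> sp Vf; have := sp.1 f (- f) Vf (lcsN Vf).
by rewrite subrr sublinear_on0//; lra.
Qed.

Lemma sublinear_onZ p a f : sublinear_on p -> 0 < a -> V f -> p (a *: f) = a * p f.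
Proof.
move=> sp a0 Vf; apply/eqP; rewrite eq_le sp.2//=.
have := sp.2 a^-1 (a *: f) ltac:(by rewrite invr_gt0) (lcsZ a Vf).
by rewrite scalerA mulVf ?gt_eqF// scale1r ler_pdivlMl.
Qed.

(* Subtracting the largest multiple of [g] that sublinearity allows; a minimal
   [s] is fixed by this operation, hence additive. *)
Let reduce (s : E -> R) (g : E) (f : E) : R :=
  inf [set s (f + t *: g) - t * s g | t in [set t : R | 0 <= t]].

Let reduce_lb s g f : sublinear_on s -> V g -> V f ->
  lbound [set s (f + t *: g) - t * s g | t in [set t : R | 0 <= t]] (- s (- f)).
Proof.
move=> ss Vg Vf _ [t /= t0 <-].
have -> : t * s g = s (t *: g).
  move: t0; rewrite le_eqVlt => /predU1P[<-|t0]; last by rewrite sublinear_onZ.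
  by rewrite mul0r scale0r sublinear_on0.
have := ss.1 (f + t *: g) (- f) (lcsD Vf (lcsZ t Vg)) (lcsN Vf).
by rewrite addrC addKr; lra.
Qed.

Let reduce_le s g f t : sublinear_on s -> V g -> V f -> 0 <= t ->
  reduce s g f <= s (f + t *: g) - t * s g.
Proof.
move=> ss Vg Vf t0; apply: ge_inf; last by exists t.
by exists (- s (- f)); apply: reduce_lb.
Qed.

Let reduce_ge s g f x :
  (forall t, 0 <= t -> x <= s (f + t *: g) - t * s g) -> x <= reduce s g f.
Proof.
move=> H; apply: lb_le_inf; first by exists (s (f + 0 *: g) - 0 * s g), 0 => /=.
by move=> _ [t /= t0 <-]; apply: H.
Qed.

Let reduce_sublinear s g : sublinear_on s -> V g -> sublinear_on (reduce s g).
Proof.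
move=> ss Vg; split=> [f1 f2 V1 V2|a f a0 Vf].
  rewrite -lerBlDl; apply: reduce_ge => t2 t20.
  rewrite lerBlDl -lerBlDr; apply: reduce_ge => t1 t10.
  rewrite lerBlDr (le_trans (reduce_le ss Vg (lcsD V1 V2) (addr_ge0 t10 t20)))//.
  rewrite scalerDl addrACA.
  have := ss.1 _ _ (lcsD V1 (lcsZ t1 Vg)) (lcsD V2 (lcsZ t2 Vg)); lra.
rewrite -ler_pdivrMl//; apply: reduce_ge => t t0.
rewrite ler_pdivrMl//.
have /le_trans -> // := reduce_le ss Vg (lcsZ a Vf) (mulr_ge0 (ltW a0) t0).
by rewrite -scalerA -scalerDr sublinear_onZ ?mulrBr ?mulrA//; apply/lcsD/lcsZ.
Qed.

(** Hahn-Banach without extension from a subspace: by Zorn's lemma there is a minimal sublinear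
    functional below [p], and minimality forces linearity. *)
Lemma linear_minorant p : sublinear_on p ->
  exists2 L, linear_on L & forall f, V f -> L f <= p f.
Proof.
move=> sp.
pose T := {s : E -> R | sublinear_on s /\ forall f, V f -> s f <= p f}.
(* The order is reversed, so that a maximal element is a minimal functional; it is only a preorder,
   since values outside [V] are ignored. *)
pose rel_ (s t : T) := `[< forall f, V f -> sval t f <= sval s f >].
have t0 : T by exists p.
have [| | |[s [ss sp']] smin] := @ZL_preorder T t0 rel_.
- by move=> t; apply/asboolP.
- move=> r s t /asboolP rs /asboolP st; apply/asboolP => f Vf.
  exact: le_trans (st _ Vf) (rs _ Vf).
- move=> A Atot.
  have [[a Aa]|A0] := pselect (A !=set0); last first.
    by exists t0 => s As; case: A0; exists s.
  (* The pointwise infimum of a nonempty chain bounds it; it is finite because every member is at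
     least [- p (- f)]. *)
  pose u f := inf [set sval s f | s in A].
  have ule s f : A s -> V f -> u f <= sval s f.
    move=> As Vf; apply: ge_inf; last by exists s.
    exists (- p (- f)) => _ [[r [sr rp]] /= Ar <-].
    have := sublinear_onN sr Vf; have := rp _ (lcsN Vf); lra.
  have leu f x : (forall s, A s -> x <= sval s f) -> x <= u f.
    move=> H; apply: lb_le_inf; first by exists (sval a f), a.
    by move=> _ [s As <-]; apply: H.
  have su : sublinear_on u.
    split=> [f g Vf Vg|b f b0 Vf].
      rewrite -lerBlDl; apply: (leu) => s As; rewrite lerBlDl -lerBlDr.
      apply: (leu) => r Ar; rewrite lerBlDr.
      (* The smaller of the two members serves for both summands. *)
      have [/asboolP rs|/asboolP rs] := Atot _ _ Ar As.
        apply: (le_trans (ule s _ As (lcsD Vf Vg))).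
        have := (svalP s).1.1 _ _ Vf Vg; have := rs _ Vf; lra.
      apply: (le_trans (ule r _ Ar (lcsD Vf Vg))).
      have := (svalP r).1.1 _ _ Vf Vg; have := rs _ Vg; lra.
    rewrite -ler_pdivrMl//; apply: (leu) => s As; rewrite ler_pdivrMl//.
    by rewrite (le_trans (ule s _ As (lcsZ b Vf)))// (svalP s).1.2.
  have up f : V f -> u f <= p f.
    by move=> Vf; apply: le_trans (ule a _ Aa Vf) _; apply: (svalP a).2.
  exists (exist _ u (conj su up)) => s As; apply/asboolP => f Vf; exact: ule.
have sD f g : V f -> V g -> s (f + g) = s f + s g.
  move=> Vf Vg; apply/eqP; rewrite eq_le ss.1//=.
  have rle h : V h -> reduce s g h <= s h.
    by move=> Vh; have := reduce_le ss Vg Vh (lexx 0); rewrite scale0r mul0r subr0 addr0.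
  have rp h : V h -> reduce s g h <= p h.
    by move=> Vh; apply: le_trans (rle _ Vh) (sp' _ Vh).
  (* Minimality gives [s f <= reduce s g f], and [t = 1] in the infimum gives
     [s f <= s (f + g) - s g]. *)
  have /asboolP := smin (exist _ (reduce s g) (conj (reduce_sublinear ss Vg) rp))
    ltac:(by apply/asboolP).
  move=> /(_ f Vf)/= sr; have := reduce_le ss Vg Vf ler01.
  by rewrite scale1r mul1r; lra.
have sN f : V f -> s (- f) = - s f.
  move=> Vf; have := sD _ _ Vf (lcsN Vf); rewrite subrr sublinear_on0//; lra.
exists s => // a f g Vf Vg; rewrite sD//; last exact: lcsZ.
congr (_ + _); have [a0|a0|->] := ltgtP a 0.
- rewrite -[a]opprK scaleNr sN ?sublinear_onZ ?oppr_gt0//; last exact: lcsZ.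
  by rewrite !mulNr.
- by rewrite sublinear_onZ.
- by rewrite scale0r mul0r sublinear_on0.
Qed.

End sublinear.

(** * Riesz representation on compact spaces *)

HB.instance Definition _ (X Y : ptopologicalType) := Pointed.on (X * Y)%type.

Definition cts (K : topologicalType) (R : realType) : set (K -> R) :=
  [set f | continuous f].
Arguments cts : clear implicits.

(** * Continuous functions on a compact space *)

Section continuous_functions.
Context {R : realType} {K : ptopologicalType}.
Implicit Types (f g : K -> R).

Lemma cts_cst (a : R) : cts K R (fun _ => a).
Proof. by move=> x; exact: cvg_cst. Qed.

Lemma ctsD f g : cts K R f -> cts K R g -> cts K R (fun x => f x + g x).
Proof. by move=> cf cg x; apply: cvgD; [exact: cf|exact: cg]. Qed.

Lemma ctsN f : cts K R f -> cts K R (fun x => - f x).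
Proof. by move=> cf x; apply: cvgN; exact: cf. Qed.

Lemma ctsB f g : cts K R f -> cts K R g -> cts K R (fun x => f x - g x).
Proof. by move=> cf cg; apply: ctsD => //; apply: ctsN. Qed.

Lemma ctsM f g : cts K R f -> cts K R g -> cts K R (fun x => f x * g x).
Proof. by move=> cf cg x; apply: cvgM; [exact: cf|exact: cg]. Qed.

Lemma ctsZ a f : cts K R f -> cts K R (fun x => a * f x).
Proof. by move=> cf; apply: ctsM => //; apply: cts_cst. Qed.

Lemma cts_min f g : cts K R f -> cts K R g -> cts K R (fun x => Num.min (f x) (g x)).
Proof. by move=> cf cg x; apply: continuous_min; [exact: cf|exact: cg]. Qed.

Lemma cts_max f g : cts K R f -> cts K R g -> cts K R (fun x => Num.max (f x) (g x)).
Proof. by move=> cf cg x; apply: continuous_max; [exact: cf|exact: cg]. Qed.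

Lemma cts_sum (I : Type) (r : seq I) (F : I -> K -> R) :
  (forall i, cts K R (F i)) -> cts K R (fun x => \sum_(i <- r) F i x).
Proof.
move=> cF; elim: r => [|i r IH].
  by under eq_fun do rewrite big_nil; apply: cts_cst.
by under eq_fun do rewrite big_cons; apply: ctsD.
Qed.

Lemma cts_linear_closed : linear_closed_set (cts K R).
Proof.
split; first exact: cts_cst.
by move=> a f g cf cg; apply: ctsD => //; apply: ctsZ.
Qed.

Lemma cts_bounded f : compact [set: K] -> cts K R f ->
  exists M, 0 < M /\ forall x, `|f x| <= M.
Proof.
move=> cK cf.
have K0 : [set: K] !=set0 by exists point.
have wf : {within setT, continuous f} by apply/continuous_subspaceT.
have [a _ Ha] := compact_EVT_max K0 cK wf.
have [b _ Hb] := compact_EVT_min K0 cK wf.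
exists (`|f a| + `|f b| + 1); split=> [|x].
  by rewrite addrC ltr_pwDl// addr_ge0.
have := Ha x (in_setT _); have := Hb x (in_setT _).
rewrite ler_norml.
have := ler_norm (f a); have := ler_norm (- f b); rewrite normrN.
have := normr_ge0 (f a); have := normr_ge0 (f b); lra.
Qed.

Lemma open_borel (U : set K) : open U -> measurable (U : set (borel K)).
Proof. exact: sub_gen_smallest. Qed.

Lemma closed_borel (U : set K) : closed U -> measurable (U : set (borel K)).
Proof.
by move=> /closed_openC /open_borel /measurableC; rewrite setCK.
Qed.

Lemma cts_measurable f : cts K R f -> measurable_fun setT (f : borel K -> R).
Proof.
move=> /continuousP cf; apply: (measurability _ (RGenOpens.measurableE R)).
move=> _ [_ [a [b ->] <-]]; rewrite setTI.
by apply: open_borel; exact/cf/interval_open.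
Qed.

End continuous_functions.
Arguments cts_cst {R K} a.
Arguments ctsZ {R K} a {f} _.

(** Positive normalised functionals on C(K). Integrals and abstract functionals are both treated as
    states and share one calculus. *)
Definition state {R : realType} {K : ptopologicalType} (L : (K -> R) -> R) :=
  [/\ linear_on (cts K R) L,
      (forall f, cts K R f -> (forall x, 0 <= f x) -> 0 <= L f) &
      L (fun=> 1) = 1].

Section state_theory.
Context {R : realType} {K : ptopologicalType} (L : (K -> R) -> R).
Hypothesis sL : state L.
Implicit Types (f g : K -> R).

Lemma state_lin a f g : cts K R f -> cts K R g ->
  L (fun x => a * f x + g x) = a * L f + L g.
Proof. by case: sL => lL _ _; exact: lL. Qed.

Lemma stateD f g : cts K R f -> cts K R g -> L (fun x => f x + g x) = L f + L g.
Proof.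
move=> cf cg; rewrite -[L f]mul1r -state_lin//.
by congr L; apply/funext => x; rewrite mul1r.
Qed.

Lemma state0 : L (fun=> 0) = 0.
Proof. by have /eqP := stateD (cts_cst 0) (cts_cst 0); rewrite addr0 -subr_eq0 opprD addNKr oppr_eq0 => /eqP. Qed.

Lemma stateZ a f : cts K R f -> L (fun x => a * f x) = a * L f.
Proof.
move=> cf; rewrite -[RHS]addr0 -state0 -state_lin//; last exact: cts_cst.
by congr L; apply/funext => x; rewrite addr0.
Qed.

Lemma stateN f : cts K R f -> L (fun x => - f x) = - L f.
Proof.
move=> cf; rewrite -mulN1r -stateZ//.
by congr L; apply/funext => x; rewrite mulN1r.
Qed.

Lemma stateB f g : cts K R f -> cts K R g -> L (fun x => f x - g x) = L f - L g.
Proof. by move=> cf cg; rewrite stateD ?stateN//; apply: ctsN. Qed.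

Lemma state_cst a : L (fun=> a) = a.
Proof.
have [_ _ L1] := sL; rewrite -[RHS]mulr1 -L1 -stateZ; last exact: cts_cst.
by congr L; apply/funext => x; rewrite mulr1.
Qed.

Lemma state_ge0 f : cts K R f -> (forall x, 0 <= f x) -> 0 <= L f.
Proof. by case: sL => _ + _; apply. Qed.

Lemma state_le f g : cts K R f -> cts K R g -> (forall x, f x <= g x) -> L f <= L g.
Proof.
move=> cf cg fg; rewrite -subr_ge0 -stateB//; apply: state_ge0; first exact: ctsB.
by move=> x; rewrite subr_ge0.
Qed.

Lemma state_sum (I : Type) (r : seq I) (F : I -> K -> R) :
  (forall i, cts K R (F i)) ->
  L (fun x => \sum_(i <- r) F i x) = \sum_(i <- r) L (F i).
Proof.
move=> cF; elim: r => [|i r IH].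
  by under eq_fun do rewrite big_nil; rewrite big_nil state0.
under eq_fun do rewrite big_cons; rewrite big_cons stateD ?IH//.
exact: cts_sum.
Qed.

End state_theory.

(** * Integration against a Borel probability as a state *)

Section borel_probability_integral.
Context {R : realType} {K : ptopologicalType}.
Hypothesis cK : compact [set: K].
Variable P : borel_probability K R.
Implicit Types (f g : K -> R).

Lemma cts_integrable f : cts K R f -> P.-integrable setT (EFin \o f).
Proof.
move=> cf; have [M [M0 fM]] := cts_bounded cK cf.
apply: measurable_bounded_integrable => //.
- by rewrite (le_lt_trans (probability_le1 P measurableT))// ltry.
- exact: cts_measurable.
- by exists M; split; [exact: num_real|move=> N MN x _]; apply: le_trans (fM x) (ltW MN).
Qed.

Lemma integralE_Rintegral f : cts K R f ->
  (\int[P]_x (f x)%:E)%E = (\int[P]_x f x)%:E.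
Proof.
by move=> cf; rewrite /Rintegral fineK//; apply: integrable_fin_num => //; apply: cts_integrable.
Qed.

Lemma Rintegral_state : state (fun f : K -> R => \int[P]_x f x).
Proof.
split=> [a f g cf cg|f cf f0|].
- rewrite -RintegralZl//; last exact: cts_integrable.
  rewrite -RintegralD//; last exact: cts_integrable.
  by apply: cts_integrable; apply: ctsZ.
- by apply: Rintegral_ge0.
- by rewrite Rintegral_cst//= (_ : P _ = 1%E) ?mulr1//; exact: probability_setT.
Qed.

End borel_probability_integral.

(** The form in which metrizability enters the Riesz construction: every open set is the positivity
    set of a continuous function. *)
Definition cozero_opens (R : realType) (K : topologicalType) :=
  forall U : set K, open U -> exists u : K -> R,
    [/\ continuous u, forall x, 0 <= u x & U = [set x | 0 < u x]].

Lemma pseudometric_cozero (R : realType) (T : pseudoMetricType R) :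
  cozero_opens R T.
Proof.
(* Distance to the complement, truncated at [1] because it is infinite when [U] is the whole
   space. *)
move=> U oU; pose d x := mine (edist_inf (~` U) x) 1%E.
have dfin x : d x \is a fin_num.
  by rewrite ge0_fin_numE /d ?le_min ?edist_inf_ge0 ?lee01// gt_min ltry orbT.
exists (fun x => fine (d x)); split=> [x|x|].
(* The truncated distance is 1-Lipschitz, by the triangle inequality. *)
- have dle e y z : 0 < e -> ball y e z -> fine (d y) <= fine (d z) + e.
    move=> e0 /(@edist_fin _ _ _ (y, z) e0) yz.
    rewrite -lee_fin EFinD !fineK// /d.
    have [zle|zgt] := leP (edist_inf (~` U) z) 1%E.
      rewrite ge_min; apply/orP; left.
      by rewrite (le_trans (edist_inf_triangle _ _ z))// [leLHS]addeC leeD2l.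
    by rewrite ge_min leeDl ?orbT// lee_fin ltW.
  apply/cvgrPdist_le => e e0; near=> y.
  have xy : ball x e y by near: y; exact: nbhsx_ballx.
  have := dle _ _ _ e0 xy; have := dle _ _ _ e0 (ball_sym xy).
  by rewrite ler_norml; lra.
- by rewrite fine_ge0// /d le_min edist_inf_ge0 lee01.
- apply/seteqP; split=> x /=; last first.
    move=> + ; apply: contraPP => nUx.
    by rewrite /d edist_inf0// min_l ?lee01//= ltxx.
  move=> Ux; rewrite -lte_fin fineK// /d lt_min lte01 andbT.
  have /nbhs_ballP[e /= e0 eU] : nbhs x U by apply: open_nbhs_nbhs.
  apply: (@lt_le_trans _ _ e%:E); first by rewrite lte_fin.
  apply: le_ereal_inf_tmp => _ [y nUy <-].
  rewrite leNgt; apply/negP => /edist_lt_ball/= xy.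
  by apply: nUy; apply: eU.
Unshelve. all: by end_near. Qed.

(** The functions [min 1 (n * u)] increase to the indicator of [U], and reach [1] at each point of
    [U] once [n] exceeds [1 / u x]. *)
Lemma open_approx (R : realType) (K : ptopologicalType) (U : set K) :
  cozero_opens R K -> open U -> exists g : nat -> K -> R,
  [/\ forall n, cts K R (g n), forall n x, 0 <= g n x, forall n x, g n x <= 1,
      forall m n x, (m <= n)%N -> g m x <= g n x &
      (forall x, U x -> exists n, g n x = 1) /\
      (forall n x, ~ U x -> g n x = 0)].
Proof.
move=> cz /cz[u [cu u0 ->]].
exists (fun n x => Num.min 1 (n%:R * u x)); split=> [n|n x|n x|m n x mn|].
- by apply: cts_min; [exact: cts_cst|exact: ctsZ].
- by rewrite le_min ler01 mulr_ge0.
- by rewrite ge_min lexx.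
- rewrite le_min ge_min lexx/= ge_min; apply/orP; right.
  by apply: ler_wpM2r => //; rewrite ler_nat.
split=> [x /= ux|n x /negP].
  exists (Num.truncn (u x)^-1).+1; apply/min_idPl.
  by rewrite -ler_pdivrMr// div1r ltW// truncnS_gt.
rewrite -leNgt => ux; have ux0 : u x = 0 by apply/eqP; rewrite eq_le ux u0.
by rewrite ux0 mulr0 min_r.
Qed.

(** * The outer measure of a state *)

Section riesz_outer.
Context {R : realType} {K : ptopologicalType} (L : (K -> R) -> R).
Hypothesis sL : state L.
Implicit Types (A : set K) (h : nat -> K -> R) (s : R).

(* Daniell-style covers: increasing sequences of continuous functions instead of
   sequences of open sets, so that a cover can be split along an open set by
   multiplying it with [g n] and [1 - g N]. *)
Definition fun_cover A h s :=
  [/\ forall n, cts K R (h n), forall n x, 0 <= h n x,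
      forall n x, h n x <= h n.+1 x, forall x, A x -> exists n, 1 <= h n x &
      forall n, L (h n) <= s].

(** A real infimum suffices: costs are nonnegative, and the constant cover [1] has cost [1]. *)
Definition riesz_val A : R := inf [set s | exists h, fun_cover A h s].

Definition riesz_outer A : \bar R := (riesz_val A)%:E.

Lemma fun_cover1 A : fun_cover A (fun _ _ => 1) 1.
Proof.
split=> //; [move=> _; exact: cts_cst|by move=> x _; exists 0%N|].
by move=> _; rewrite state_cst.
Qed.

Lemma fun_cover_ge0 A h s : fun_cover A h s -> 0 <= s.
Proof. by case=> ch h0 _ _ /(_ 0%N); apply: le_trans; apply: state_ge0. Qed.

Lemma fun_cover_le A h s m n x : fun_cover A h s -> (m <= n)%N -> h m x <= h n x.
Proof. by case=> _ _ hS _ _; move: m n; apply/nondecreasing_seqP => n; exact: hS. Qed.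

Lemma riesz_val_le A h s : fun_cover A h s -> riesz_val A <= s.
Proof.
move=> Ah; apply: ge_inf; last by exists h.
by exists 0 => t [g /fun_cover_ge0].
Qed.

Lemma riesz_val_ge A x : (forall h s, fun_cover A h s -> x <= s) -> x <= riesz_val A.
Proof.
move=> H; apply: lb_le_inf; first by exists 1, (fun _ _ => 1); exact: fun_cover1.
by move=> s [h]; exact: H.
Qed.

Lemma riesz_val_adherent A e : 0 < e ->
  exists hs : (nat -> K -> R) * R, fun_cover A hs.1 hs.2 /\ hs.2 < riesz_val A + e.
Proof.
move=> e0; have [|s [h Ah] sA] := @inf_adherent _ [set s | exists h, fun_cover A h s] _ e0.
  split; first by exists 1, (fun _ _ => 1); exact: fun_cover1.
  by exists 0 => t [g /fun_cover_ge0].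
by exists (h, s).
Qed.

Lemma riesz_outer_ge0 A : (0 <= riesz_outer A)%E.
Proof. by rewrite lee_fin; apply: riesz_val_ge => h s /fun_cover_ge0. Qed.

Lemma riesz_outer0 : riesz_outer set0 = 0%E.
Proof.
apply/eqP; rewrite eq_le riesz_outer_ge0 andbT lee_fin.
apply: (@riesz_val_le _ (fun _ _ => 0)); split=> //.
  by move=> _; exact: cts_cst.
by move=> _; rewrite state_cst.
Qed.

Lemma le_riesz_outer : {homo riesz_outer : A B / A `<=` B >-> (A <= B)%E}.
Proof.
move=> A B AB; rewrite lee_fin; apply: riesz_val_ge => h s [ch h0 hS hB hs].
by apply: (@riesz_val_le _ h); split=> // x /AB; exact: hB.
Qed.

Lemma riesz_outer_sigma_subadditive : sigma_subadditive riesz_outer.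
Proof.
move=> F; set S := (X in (_ <= X)%E).
have S0 : (0 <= S)%E by apply: nneseries_ge0 => i _ _; exact: riesz_outer_ge0.
have [->|] := eqVneq S +oo%E; first by rewrite leey.
rewrite -ltey -ge0_fin_numE// => Sfin; rewrite -(fineK Sfin).
have Fsum n : \sum_(i < n) riesz_val (F i) <= fine S.
  rewrite -lee_fin fineK// -sumEFin -(big_mkord xpredT (fun i => riesz_outer (F i))).
  by apply: nneseries_lim_ge => i _ _; exact: riesz_outer_ge0.
rewrite lee_fin; apply/ler_addgt0Pr => e e0.
have /choice[hs hsP] : forall i, exists hs : (nat -> K -> R) * R,
    fun_cover (F i) hs.1 hs.2 /\ hs.2 < riesz_val (F i) + e / 2 ^+ i.+1.
  by move=> i; apply: riesz_val_adherent; rewrite divr_gt0// exprn_gt0.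
(* Diagonal sum of the covers: finite, hence continuous at each stage, and increasing since each
   stage raises the old terms and adds a nonnegative one. *)
pose H n x := \sum_(i < n.+1) (hs i).1 n x.
apply: (@riesz_val_le _ H); split=> [n|n x|n x|x [i _ Fix]|n].
- by apply: cts_sum => i; have [[]] := hsP i.
- by apply: sumr_ge0 => i _; have [[]] := hsP i.
- rewrite /H [leRHS]big_ord_recr/= ler_wpDr//; first by have [[]] := hsP n.+1.
  by apply: ler_sum => i _; have [[]] := hsP i.
- have [[ch h0 hS /(_ x Fix)[n hn] _] _] := hsP i.
  exists (maxn i n); apply: (le_trans hn).
  have im : (i < (maxn i n).+1)%N by rewrite ltnS leq_maxl.
  rewrite /H (bigD1 (Ordinal im))//= ler_wpDr//.
    by apply: sumr_ge0 => j _; have [[]] := hsP j.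
  by apply: (fun_cover_le _ (hsP i).1); exact: leq_maxr.
- rewrite state_sum//; last by move=> i; have [[]] := hsP i.
  (* The errors allotted to the covers add up to less than [e]. *)
  have geo m : \sum_(i < m) e / 2 ^+ i.+1 = e - e / 2 ^+ m.
    elim: m => [|m IH]; first by rewrite big_ord0 expr0 divr1 subrr.
    by rewrite big_ord_recr/= IH exprS; field; rewrite expf_neq0.
  apply: (@le_trans _ _ (\sum_(i < n.+1) (riesz_val (F i) + e / 2 ^+ i.+1))).
    apply: ler_sum => i _; have [[_ _ _ _ /(_ n) h1] h2] := hsP i.
    exact: le_trans h1 (ltW h2).
  rewrite big_split/= lerD ?Fsum// geo gerBl.
  by rewrite ltW// divr_gt0// exprn_gt0.
Qed.

HB.instance Definition _ := isOuterMeasure.Build R K riesz_outer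
  riesz_outer0 riesz_outer_ge0 le_riesz_outer riesz_outer_sigma_subadditive.

(** A cover [h] of [E] splits along the approximations [g] of [U]: [h n * g n] covers the part
    inside [U], and [h n * (1 - g N)] the part outside, where [g N] vanishes. The costs add up to at
    most [s + e] for a suitable [N]. *)
Lemma open_caratheodory (U : set K) : cozero_opens R K -> open U ->
  riesz_outer.-caratheodory U.
Proof.
move=> cz oU; have [g [cg g0 g1 gS [gU gC]]] := open_approx cz oU.
apply: le_caratheodory_measurable => E /=.
rewrite -EFinD lee_fin; apply: riesz_val_ge => h s hE.
have [ch h0 hS hE1 hs] := hE.
have chg m n : cts K R (fun x => h m x * g n x) by apply: ctsM.
pose S := sup (range (fun n => L (fun x => h n x * g n x))).
have Sub : has_ubound (range (fun n => L (fun x => h n x * g n x))).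
  exists s => _ [n _ <-]; apply: le_trans (hs n); apply: state_le => // x.
  by rewrite ler_piMr.
have leS n : L (fun x => h n x * g n x) <= S by apply: ub_le_sup => //; exists n.
apply/ler_addgt0Pr => e e0.
(* [N] brings [L (h N * g N)] within [e] of the cost [S] of the inner cover. *)
have [|_ [N _ <-] SN] := @sup_adherent _ (range (fun n => L (fun x => h n x * g n x))) _ e0.
  by split=> //; exists (L (fun x => h 0%N x * g 0%N x)), 0%N.
have SU : riesz_val (E `&` U) <= S.
  apply: (@riesz_val_le _ (fun n x => h n x * g n x)); split=> [//|n x|n x|x [Ex Ux]|//].
  - by rewrite mulr_ge0.
  - by rewrite ler_pM ?gS.
  - have [m hm] := hE1 _ Ex; have [n gn] := gU _ Ux.
    exists (maxn m n); rewrite (_ : g _ x = 1) ?mulr1.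
      exact: le_trans hm (fun_cover_le _ hE (leq_maxl _ _)).
    by apply/eqP; rewrite eq_le g1/= -[leLHS]gn; apply: gS; exact: leq_maxr.
(* Starting the cover at index [N] ensures [h (n + N) * g N >= h N * g N], so at least
   [L (h N * g N)] is removed from the cost. *)
have SC : riesz_val (E `&` ~` U) <= s - L (fun x => h N x * g N x).
  apply: (@riesz_val_le _ (fun n x => h (n + N)%N x - h (n + N)%N x * g N x)).
  split=> [n|n x|n x|x [Ex Ux]|n].
  - exact: ctsB.
  - by rewrite subr_ge0 ler_piMr.
  - by rewrite addSn; have := hS (n + N)%N x; have := g1 N x; nra.
  - have [m hm] := hE1 _ Ex; exists m; rewrite gC// mulr0 subr0.
    exact: le_trans hm (fun_cover_le _ hE (leq_addr _ _)).
  - rewrite stateB//; apply: lerB => //; apply: state_le => // x.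
    by rewrite ler_wpM2r//; apply: (fun_cover_le _ hE); exact: leq_addl.
have := SN; rewrite -/S; lra.
Qed.

(** The lower bound is a Dini argument: an increasing cover of a compact space exceeds [1 - e]
    everywhere at a single index, where [L] is then at least [1 - e]. *)
Lemma riesz_outer_setT : compact [set: K] -> riesz_outer setT = 1%E.
Proof.
move=> /compact_near_coveringP cK.
apply/eqP; rewrite eq_le !lee_fin (riesz_val_le (fun_cover1 _))/=.
apply: riesz_val_ge => h s hT; apply/ler_addgt0Pr => e e0.
have [ch h0 hS h1 hs] := hT.
have [] := cK nat \oo (fun n x => 1 - e < h n x) _ _.
  move=> x _; have [n hn] := h1 x I.
  exists ([set y | 1 - e < h n y], [set m | (n <= m)%N]).
    split; last by exists n.
    apply: open_nbhs_nbhs; split=> /=; last by apply: lt_le_trans hn; rewrite gtrBl.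
    by apply: (@open_comp _ _ (h n) [set y | 1 - e < y]) => [y _|]; [exact: ch|exact: open_gt].
  by move=> [y m] [/= hy nm]; apply: lt_le_trans hy (fun_cover_le _ hT nm).
move=> n _ /(_ n (leqnn n)) nT.
rewrite -lerBlDr; apply: le_trans (hs n); rewrite -(state_cst sL (1 - e)).
by apply: state_le => //; [exact: cts_cst|move=> x; apply: ltW; exact: nT].
Qed.

(** * The Borel probability representing a state *)

Section riesz_measure.
Hypothesis cz : cozero_opens R K.
Hypothesis cK : compact [set: K].

Let borel_caratheodory (A : set (borel K)) : measurable A ->
  (riesz_outer).-cara.-measurable A.
Proof.
have : <<s @open K >> `<=` (riesz_outer).-cara.-measurable.
  apply: smallest_sub; first exact: sigma_algebra_measurable.
  by move=> U oU; exact: open_caratheodory.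
by apply.
Qed.

Definition riesz_measure : set (borel K) -> \bar R := riesz_outer.

Let riesz_measure_sigma_additive : semi_sigma_additive riesz_measure.
Proof.
move=> F mF tF mUF.
apply: (@caratheodory_measure_sigma_additive R K riesz_outer) => //.
- by move=> i; apply: borel_caratheodory.
- exact: borel_caratheodory.
Qed.

HB.instance Definition _ := isMeasure.Build _ _ _ riesz_measure
  riesz_outer0 riesz_outer_ge0 riesz_measure_sigma_additive.

HB.instance Definition _ := Measure_isProbability.Build _ _ _ riesz_measure
  (riesz_outer_setT cK).

Let P : borel_probability K R := riesz_measure.

(** With [f] cut into [N] layers, each integrated layer is compared with the previous layer under
    [L]. The shift costs only the lowest layer, an error [1/N <= e] after rescaling. *)
Lemma riesz_measure_le f : cts K R f -> (forall x, 0 <= f x <= 1) ->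
  \int[P]_x f x <= L f.
Proof.
move=> cf f01.
have sP : state (fun f : K -> R => \int[P]_x f x) by exact: Rintegral_state.
apply/ler_addgt0Pr => e e0.
pose N := (Num.truncn e^-1).+1.
have N0 : 0 < N%:R :> R by rewrite ltr0n.
have Ne : N%:R^-1 <= e.
  by rewrite invf_ple// ltW// truncnS_gt.
(* Layer cake: the [F j] add up to [N * f], and
   [F j.+1 <= \1_[set x | 1 <= F j x] <= F j]. *)
pose F j x := Num.min (Num.max (N%:R * f x - j%:R) 0) 1.
have cF j : cts K R (F j).
  apply: cts_min; last exact: cts_cst.
  apply: cts_max; last exact: cts_cst.
  by apply: ctsB; [exact: ctsZ|exact: cts_cst].
(* As [f <= 1], the layers from [N] on vanish; this is used with both [N] and [N.+1] layers. *)
have Fsum n x : \sum_(j < n) F j x = Num.min (N%:R * f x) n%:R.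
  have y0 : 0 <= N%:R * f x by rewrite mulr_ge0// (andP (f01 x)).1.
  elim: n => [|n IH]; first by rewrite big_ord0 min_r.
  rewrite big_ord_recr/= IH /F -natr1.
  move: (N%:R * f x) y0 => y y0; have n0 : 0 <= n%:R :> R by [].
  by case: (leP y n%:R) => ?; case: (leP y (n%:R + 1)) => ?;
    case: (leP (y - n%:R) 0) => ?; try case: leP => ?; lra.
have FN n x : (N <= n)%N -> \sum_(j < n) F j x = N%:R * f x.
  move=> Nn; rewrite Fsum min_l//.
  apply: (@le_trans _ _ N%:R); last by rewrite ler_nat.
  by rewrite ler_piMr// (andP (f01 x)).2.
(* The superlevel set [A] is covered by the constant sequence [F j], so its measure is at most
   [L (F j)]. *)
have step j : \int[P]_x F j.+1 x <= L (F j).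
  pose A := [set x | 1 <= F j x].
  have mA : measurable (A : set (borel K)).
    apply: closed_borel.
    apply: (@closed_comp _ _ (F j) [set y | 1 <= y]) => [x _|]; first exact: cF.
    exact: closed_ge.
  apply: (@le_trans _ _ (riesz_val A)); last first.
    apply: (@riesz_val_le _ (fun _ => F j)); split=> [//|_ x|//|x Ax|//].
      by rewrite le_min ler01 le_max lexx orbT.
    by exists 0%N.
  rewrite -lee_fin -/(riesz_outer A) -[leRHS]/(P A).
  rewrite -integralE_Rintegral// -[A in leRHS]setIT -integral_indic//.
  apply: ge0_le_integral => //.
  - by move=> x _; rewrite lee_fin le_min ler01 le_max lexx orbT.
  - by apply/measurable_EFinP; exact: cts_measurable.
  - by apply/measurable_EFinP; exact: measurable_indic.
  - move=> x _; rewrite lee_fin indicE.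
    have [xA|/negP] := boolP (x \in A); first by rewrite ge_min lexx orbT.
    rewrite inE /A /= => /negP; rewrite -ltNge => xA.
    have yj : N%:R * f x < j%:R + 1.
      rewrite ltNge; apply: contraTN xA => yj; rewrite -leNgt.
      by rewrite le_min lexx andbT le_max; apply/orP; left; lra.
    by rewrite /F -natr1 max_r ?min_l//; lra.
have F0 : \int[P]_x F 0%N x <= 1.
  rewrite -[leRHS](state_cst sP); apply: state_le => //; first exact: cts_cst.
  by move=> x; rewrite ge_min lexx orbT.
have : N%:R * \int[P]_x f x <= 1 + N%:R * L f.
  rewrite -(stateZ sP)// -(stateZ sL)//.
  have -> : (fun x => N%:R * f x) = (fun x => \sum_(j < N) F j x).
    by apply/funext => x; rewrite FN.
  rewrite [in leRHS](state_sum sL)//.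
  (* A vanishing top layer is added, so that [N] layers [F j.+1] remain once [F 0] is split off. *)
  have -> : (fun x => \sum_(j < N) F j x) = (fun x => \sum_(j < N.+1) F j x).
    by apply/funext => x; rewrite !FN.
  rewrite (state_sum sP)// big_ord_recl lerD//; apply: ler_sum => j _; exact: step.
by rewrite -ler_pdivlMl// mulrDr mulr1 mulKf ?gt_eqF// addrC => /le_trans -> //; rewrite lerD2l.
Qed.

(** An affine change of scale carries the inequality for values in [[0, 1]] to every continuous [f];
    applied to [- f] it gives the reverse one. *)
Theorem riesz_representation : exists P : borel_probability K R,
  forall f, cts K R f -> \int[P]_x f x = L f.
Proof.
exists P.
have sP : state (fun f : K -> R => \int[P]_x f x) by exact: Rintegral_state.
have le f : cts K R f -> \int[P]_x f x <= L f.
  move=> cf; have [M [M0 fM]] := cts_bounded cK cf.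
  have M2 : 0 < 2 * M by lra.
  have [g [cg g01 fE]] : exists g, [/\ cts K R g, forall x, 0 <= g x <= 1 &
      f = (fun x => 2 * M * g x - M)].
    exists (fun x => (2 * M)^-1 * (f x + M)); split=> [|x|].
    - by apply/ctsZ/ctsD => //; exact: cts_cst.
    - have := fM x; rewrite ler_norml => /andP[? ?].
      by rewrite ler_pdivlMl// ler_pdivrMl//; apply/andP; split; lra.
    - by apply/funext => x; field; rewrite gt_eqF.
  have stateE S : state S -> S f = 2 * M * S g - M.
    by move=> sS; rewrite fE (stateB sS) ?(stateZ sS) ?(state_cst sS)//; [exact: ctsZ|exact: cts_cst].
  rewrite (stateE _ sP) (stateE _ sL) lerB//.
  by apply: ler_wpM2l; [exact: ltW|exact: riesz_measure_le].
move=> f cf; apply/eqP; rewrite eq_le le//=.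
have := le _ (ctsN cf); rewrite (stateN sP)// (stateN sL)//; lra.
Qed.

End riesz_measure.

End riesz_outer.

(** * Uniqueness of a measure with given integrals of continuous functions *)

Section measure_determined_by_cts.
Context {R : realType} {K : ptopologicalType}.
Hypothesis cz : cozero_opens R K.

Lemma cvg_integral_open_approx (m : {measure set (borel K) -> \bar R})
    (U : set K) (g : nat -> K -> R) : open U ->
  (forall n, cts K R (g n)) -> (forall n x, 0 <= g n x) ->
  (forall n x, g n x <= 1) ->
  (forall i j x, (i <= j)%N -> g i x <= g j x) ->
  (forall x, U x -> exists n, g n x = 1) ->
  (forall n x, ~ U x -> g n x = 0) ->
  (\int[m]_x (g n x)%:E)%E @[n --> \oo] --> m U.
Proof.
move=> oU cg g0 g1 gS gU gC.
have mU : measurable (U : set (borel K)) by exact: open_borel.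
rewrite -[U in m U]setIT -(integral_indic _ measurableT mU).
have limg x : (g n x)%:E @[n --> \oo] --> ((\1_U x)%:E : \bar R).
  apply: cvg_near_cst; rewrite indicE.
  have [|/negP] := boolP (x \in U); rewrite inE.
    move=> /gU[N gN]; exists N => // n /= Nn; congr EFin.
    by apply/eqP; rewrite eq_le g1/= -gN gS.
  by move=> nUx; apply: nearW => n; rewrite gC.
have -> : (\int[m]_x (\1_U x)%:E = \int[m]_x (limn (fun n => (g n x)%:E)))%E.
  by apply: eq_integral => x _; apply/esym/cvg_lim.
apply: (@cvg_monotone_convergence _ _ _ m _ measurableT (fun n x => (g n x)%:E)).
- by move=> n; apply/measurable_EFinP; exact: cts_measurable.
- by move=> n x _; rewrite lee_fin.
- by move=> x _ i j ij; rewrite lee_fin gS.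
Qed.

(** Monotone convergence gives agreement on open sets, which are stable under intersection and
    generate the Borel sets. *)
Lemma measure_eq_of_cts (m1 m2 : {measure set (borel K) -> \bar R}) :
  (m1 setT < +oo)%E ->
  (forall f, cts K R f -> (forall x, 0 <= f x) ->
    (\int[m1]_x (f x)%:E = \int[m2]_x (f x)%:E)%E) ->
  forall A : set (borel K), measurable A -> m1 A = m2 A.
Proof.
move=> m1fin m12 A mA.
apply: (@measure_unique _ _ (borel K) (@open K) (fun=> setT)) => //.
- by move=> U V oU oV; exact: openI.
- by move=> _; exact: openT.
- by apply/seteqP; split=> // x _; exists 0%N.
move=> U oU; have [g [cg g0 g1 gS [gU gC]]] := open_approx cz oU.
have c1 := cvg_integral_open_approx (m := m1) oU cg g0 g1 gS gU gC.
have c2 := cvg_integral_open_approx (m := m2) oU cg g0 g1 gS gU gC.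
have E : (fun n => \int[m1]_x (g n x)%:E)%E = (fun n => \int[m2]_x (g n x)%:E)%E.
  by apply/funext => n; exact: m12.
by move: c1; rewrite E => c1; apply: (cvg_unique _ c1 c2); exact: ereal_hausdorff.
Qed.

End measure_determined_by_cts.

(** * Marginals tested on continuous functions *)

Section marginal.
Context {R : realType} {X Z : pmetricType R}.
Implicit Types (mu : borel_probability X R).
Implicit Types (pi : borel_probability (X * Z)%type R).

Let fst_borel : borel (X * Z)%type -> borel X := fst.

(** The product carries the Borel sigma-algebra of its topology, so measurability is derived from
    continuity of the projection. *)
Lemma measurable_fst_borel : measurable_fun setT fst_borel.
Proof.
apply: (@measurability _ _ (borel (X * Z)%type) (borel X) setT fst_borel (@open X)) => //.
move=> _ [U oU <-]; rewrite setTI; apply: open_borel.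
by apply: (@open_comp _ _ (@fst X Z)) => // p _; exact: cvg_fst.
Qed.

Lemma cts_fst (phi : X -> R) : cts X R phi -> cts (X * Z)%type R (fun p => phi p.1).
Proof.
move=> cphi p; apply: (@continuous_comp _ _ _ fst phi); first exact: cvg_fst.
exact: cphi.
Qed.

Lemma integral_pushforward_fst pi (phi : X -> R) : cts X R phi ->
  (forall x, 0 <= phi x) ->
  (\int[pushforward pi fst_borel]_x (phi x)%:E = \int[pi]_p (phi p.1)%:E)%E.
Proof.
move=> cphi phi0.
rewrite (ge0_integral_pushforward measurable_fst_borel)//.
by apply/measurable_EFinP; exact: cts_measurable.
by move=> x _; rewrite lee_fin.
Qed.

Hypothesis cX : compact [set: X].
Hypothesis cZ : compact [set: Z].

Lemma compact_prod : compact [set: X * Z].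
Proof. by rewrite -setXTT; exact: compact_setX. Qed.

Lemma has_XmarginalP mu pi : has_Xmarginal mu pi <->
  (forall phi, cts X R phi -> \int[pi]_p phi p.1 = \int[mu]_x phi x).
Proof.
have spi := Rintegral_state compact_prod pi.
have smu := Rintegral_state cX mu.
split=> [H phi cphi|H A mA].
  have pos f : cts X R f -> (forall x, 0 <= f x) -> \int[pi]_p f p.1 = \int[mu]_x f x.
    move=> cf f0; apply: EFin_inj.
    rewrite -(integralE_Rintegral compact_prod pi (cts_fst cf)).
    rewrite -(integralE_Rintegral cX mu cf) -integral_pushforward_fst//.
    by apply: eq_measure_integral => [|? B mB _]; [exact: measurable_fst_borel|exact: (H B mB)].
  have [M [M0 phiM]] := cts_bounded cX cphi.
  (* Adding a bound [M] of [phi] reduces to the nonnegative case; both integrals grow by [M]. *)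
  have := pos (fun x => phi x + M) (ctsD cphi (cts_cst M)).
  rewrite (stateD smu) ?(state_cst smu)//; last exact: cts_cst.
  rewrite (stateD spi (cts_fst cphi) (cts_cst M)) (state_cst spi).
  by move=> /(_ _)/addIr; apply => x; have := phiM x; rewrite ler_norml; lra.
apply: (@measure_eq_of_cts R X (@pseudometric_cozero R X)
  (pushforward pi fst_borel) mu) => //.
- exact: measurable_fst_borel.
- by move=> ?; rewrite -[X in (X < _)%E]/(pi setT) probability_setT ltry.
- move=> ? f cf f0; rewrite integral_pushforward_fst//.
  rewrite (integralE_Rintegral compact_prod pi (cts_fst cf)) H//.
  by rewrite (integralE_Rintegral cX mu cf).
Qed.

End marginal.

(** * Probabilities satisfying a sublinear family of bounds *)

Section dominated_probability.
Context {R : realType} {K : ptopologicalType}.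
Hypotheses (cz : cozero_opens R K) (cK : compact [set: K]).
(* [S f M] records an upper bound [M] to be imposed on the integral of [f]; the
   sublinear functional is [f |-> inf [set M | S f M]]. *)
Variable S : (K -> R) -> R -> Prop.
Hypothesis S0 : forall M, S (fun=> 0) M -> 0 <= M.
Hypothesis S_ub : forall f m e, cts K R f -> (forall x, f x <= m) -> 0 < e ->
  S f (m + e).
Hypothesis SD : forall f g M N, cts K R f -> cts K R g -> S f M -> S g N ->
  S (fun x => f x + g x) (M + N).
Hypothesis SZ : forall a f M, 0 < a -> cts K R f -> S f M ->
  S (fun x => a * f x) (a * M).

Let inf_S f := inf [set M | S f M].

(** A bound for [f] plus the trivial bound for [- f] is a bound for [0], hence nonnegative. *)
Let S_lb f : cts K R f -> exists m, lbound [set M | S f M] m.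
Proof.
move=> cf; have [B [B0 fB]] := cts_bounded cK cf.
exists (- (B + 1)) => M /= SfM; rewrite -subr_ge0 opprK addrC; apply: S0.
have SN : S (fun x => - f x) (B + 1).
  apply: S_ub => //; first exact: ctsN.
  by move=> x; have := fB x; rewrite ler_norml; lra.
have := SD (ctsN cf) cf SN SfM.
by rewrite (_ : (fun x => - f x + f x) = fun=> 0)//; apply/funext => x; rewrite addNr.
Qed.

Let inf_S_le f M : cts K R f -> S f M -> inf_S f <= M.
Proof. by move=> cf SfM; apply: ge_inf => //; exact: S_lb. Qed.

Let inf_S_ge f x : cts K R f -> (forall M, S f M -> x <= M) -> x <= inf_S f.
Proof.
move=> cf H; apply: lb_le_inf => //.
have [B [B0 fB]] := cts_bounded cK cf; exists (B + 1); apply: S_ub => // y.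
by have := fB y; rewrite ler_norml => /andP[].
Qed.

Let inf_S_ub f m : cts K R f -> (forall x, f x <= m) -> inf_S f <= m.
Proof.
by move=> cf fm; apply/ler_addgt0Pr => e e0; apply: inf_S_le => //; apply: S_ub.
Qed.

Let inf_S_sublinear : sublinear_on (cts K R) inf_S.
Proof.
split=> [f g cf cg|a f a0 cf].
  rewrite -lerBlDl; apply: inf_S_ge => // N SgN.
  rewrite lerBlDl -lerBlDr; apply: inf_S_ge => // M SfM.
  by rewrite lerBlDr; apply: inf_S_le; [exact: ctsD|exact: SD].
rewrite -ler_pdivrMl//; apply: inf_S_ge => // M SfM; rewrite ler_pdivrMl//.
by apply: inf_S_le; [exact: ctsZ|exact: SZ].
Qed.

(** A linear minorant of [inf_S] satisfies [L f <= m] whenever [f <= m]. Applied to [- f] for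
    [f >= 0] and to the constants [1] and [-1], this makes [L] a state, which the Riesz theorem
    represents. *)
Lemma dominated_probability : exists P : borel_probability K R,
  forall f M, cts K R f -> S f M -> \int[P]_x f x <= M.
Proof.
have [L lL Lle] := linear_minorant cts_linear_closed inf_S_sublinear.
have Lub f m : cts K R f -> (forall x, f x <= m) -> L f <= m.
  by move=> cf fm; apply: le_trans (Lle _ cf) (inf_S_ub cf fm).
have LN f : cts K R f -> L (fun x => - f x) = - L f.
  move=> cf; have := lL (-1) f f cf cf; have := lL (-2) f f cf cf.
  (* Linearity with factor [-2] and [f] in both places yields the negation. *)
  rewrite (_ : -2 *: f + f = (fun x => - f x)).
    by move=> -> _; ring.
  by apply/funext => x /=; rewrite -[(_ + _) x]/(-2 * f x + f x); ring.
have sL : state L.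
  split=> [//|f cf f0|].
    rewrite -oppr_le0 -LN//; apply: Lub; first exact: ctsN.
    by move=> x; rewrite oppr_le0.
  apply/eqP; rewrite eq_le Lub//=; last exact: cts_cst.
  rewrite -lerN2 -LN; last exact: cts_cst.
  by apply: Lub => //; exact: cts_cst.
have [P PL] := riesz_representation sL cz cK.
exists P => f M cf SfM; rewrite PL//.
exact: le_trans (Lle _ cf) (inf_S_le cf SfM).
Qed.

End dominated_probability.

(** * Entropy and pressure *)

Section holonomic_entropy.
Context {R : realType} {X Z : pmetricType R}.
Hypotheses (cX : compact [set: X]) (cZ : compact [set: Z]).
Variables (tau : X -> Z -> Z) (tau_contr : uniformly_contractive tau).
Variable alpha : borel_probability X R.
Implicit Types (f g b k : X * Z -> R) (h : Z -> R).
Implicit Types (pi : borel_probability (X * Z)%type R).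

Let K := (X * Z)%type : ptopologicalType.
Let cK : compact [set: X * Z] := compact_prod cX cZ.

Lemma near_dist_sum (p : X * Z) (e : R) : 0 < e -> \forall q \near p, dist_sum p q < e.
Proof.
move=> e0; have e2 : 0 < e / 2 by rewrite divr_gt0.
exists (ball p.1 (e / 2), ball p.2 (e / 2)).
  by split; exact: nbhsx_ballx.
by move=> q [/=]; rewrite !ballEmdist /= /dist_sum => ? ?; rewrite (splitr e) ltrD.
Qed.

Lemma is_lipschitz_cts b : is_lipschitz b -> cts K R b.
Proof.
move=> [L bL] p; apply/cvgrPdist_lt => e e0.
have L0 : 0 < `|L| + 1 by rewrite ltr_wpDl.
near=> q; apply: le_lt_trans (bL p q) _.
have pq : dist_sum p q < e / (`|L| + 1).
  by near: q; apply: near_dist_sum; rewrite divr_gt0.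
have d0 : 0 <= dist_sum p q by rewrite addr_ge0 ?mdist_ge0.
move: pq; rewrite ltr_pdivlMr// => pq.
have := ler_norm L; nra.
Unshelve. all: by end_near. Qed.

(** Contractivity for the sum metric makes [tau] jointly continuous. *)
Lemma cts_tau h : cts Z R h -> cts K R (fun p => h (tau p.1 p.2)).
Proof.
move=> ch p; apply: (@continuous_comp _ _ _ (fun p : X * Z => tau p.1 p.2) h).
  have [gam /andP[g0 g1] tauL] := tau_contr.
  apply/metricType_numDomainType.cvgrPdist_lt => e e0.
  near=> q; apply: le_lt_trans (tauL p q) _.
  have pq : dist_sum p q < e by near: q; exact: near_dist_sum.
  have d0 : 0 <= dist_sum p q by rewrite addr_ge0 ?mdist_ge0.
  nra.
exact: ch.
Unshelve. all: by end_near. Qed.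

Lemma cts_snd h : cts Z R h -> cts K R (fun p => h p.2).
Proof.
move=> ch p; apply: (@continuous_comp _ _ _ snd h); first exact: cvg_snd.
exact: ch.
Qed.

Lemma cts_slice f z : cts K R f -> cts X R (fun x => f (x, z)).
Proof.
move=> cf x; apply: (@continuous_comp _ _ _ (fun x => (x, z)) f); last exact: cf.
by apply: cvg_pair; [exact: cvg_id|exact: cvg_cst].
Qed.

Lemma holonomicP pi : holonomic tau pi <->
  forall h, cts Z R h -> \int[pi]_p h (tau p.1 p.2) = \int[pi]_p h p.2.
Proof.
split=> H h ch; last first.
  by rewrite (integralE_Rintegral cK pi (cts_tau ch)) (integralE_Rintegral cK pi (cts_snd ch)) H.
by rewrite /Rintegral; congr fine; exact: H.
Qed.

Definition normalized b :=
  is_lipschitz b /\ transfer tau alpha b (cst 1) = cst 1.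

Lemma normalized0 : normalized (fun=> 0).
Proof.
split; first by exists 0 => p q; rewrite subrr normr0 mul0r.
apply/funext => z; rewrite /transfer /= -[RHS](state_cst (Rintegral_state cX alpha)).
by apply: eq_Rintegral => x _; rewrite expR0 mul1r.
Qed.

Lemma normalized_int_le0 b z : normalized b -> \int[alpha]_x b (x, z) <= 0.
Proof.
move=> [lb /(congr1 (@^~ z))]; rewrite /transfer /= => e1.
have cb : cts X R (fun x => b (x, z)) by apply/cts_slice/is_lipschitz_cts.
have ce : cts X R (fun x => expR (b (x, z))).
  by move=> x; apply: (@continuous_comp _ _ _ (fun x => b (x, z))); [exact: cb|exact: continuous_expR].
have salpha := Rintegral_state cX alpha.
rewrite -subr_le0 in e1 *; rewrite subr0.
apply: (@le_trans _ _ (\int[alpha]_x (expR (b (x, z)) - 1))).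
  apply: (state_le salpha) => //; first by apply: ctsB => //; exact: cts_cst.
  by move=> x; have := expR_ge1Dx (b (x, z)); lra.
rewrite (stateB salpha)//; last exact: cts_cst.
rewrite (state_cst salpha) subr_le0 -[leRHS]e1 le_eqVlt; apply/orP; left; apply/eqP.
by apply: eq_Rintegral => x _; rewrite mulr1.
Qed.

Lemma entropy_le pi b : normalized b ->
  (entropy tau alpha pi <= (- \int[pi]_p b p)%:E)%E.
Proof.
move=> nb; rewrite /entropy EFinN leeN2.
rewrite -(integralE_Rintegral cK pi (is_lipschitz_cts nb.1)).
by apply: ereal_sup_ubound; exists b.
Qed.

Lemma entropy_ge pi v : (forall b, normalized b -> \int[pi]_p b p <= - v) ->
  (v%:E <= entropy tau alpha pi)%E.
Proof.
move=> H; rewrite /entropy leeNr; apply: ge_ereal_sup => _ [b nb <-].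
by rewrite (integralE_Rintegral cK pi (is_lipschitz_cts nb.1)) -EFinN lee_fin H.
Qed.

Lemma entropy_le0 pi : (entropy tau alpha pi <= 0)%E.
Proof.
apply: le_trans (entropy_le pi normalized0) _.
by rewrite (state_cst (Rintegral_state cK pi)) oppr0.
Qed.

Lemma exists_holonomic_entropy_ge0 :
  exists2 pi, holonomic tau pi & (0 <= entropy tau alpha pi)%E.
Proof.
have salpha := Rintegral_state cX alpha.
pose A f h z := \int[alpha]_x (f (x, z) + h (tau x z) - h z).
have cA f h z : cts K R f -> cts Z R h -> cts X R (fun x => f (x, z) + h (tau x z) - h z).
  move=> cf ch; apply: ctsB; last exact: cts_cst.
  by apply: ctsD; [exact: cts_slice|exact: (@cts_slice (fun p => h (tau p.1 p.2)) z (cts_tau ch))].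
have c0 : cts K R (fun=> 0) by exact: cts_cst.
have d0 : cts Z R (fun=> 0) by exact: cts_cst.
(* [M] bounds the [alpha]-averages of [f] after a coboundary is added. *)
pose S f M := exists2 h, cts Z R h & forall z, A f h z <= M.
have [| | | |pi piS] := @dominated_probability R K (@pseudometric_cozero R (X * Z)%type) cK S.
- move=> M [h ch hM].
  (* At a minimum point [z] of [h] the coboundary is nonnegative, and so is its average. *)
  have [z _ hz] : exists2 z, z \in [set: Z] & forall t, t \in [set: Z] -> h z <= h t.
    apply: compact_EVT_min => //; first by exists point.
    exact/continuous_subspaceT.
  apply: le_trans (hM z); rewrite -[leLHS](state_cst salpha); apply: (state_le salpha).
  + exact: cts_cst.
  + exact: (cA _ h z c0 ch).
  + by move=> x; rewrite add0r subr_ge0 hz// in_setT.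
- move=> f m e cf fm e0; exists (fun=> 0); first exact: cts_cst.
  move=> z; rewrite -[leRHS](state_cst salpha); apply: (state_le salpha).
  + exact: (cA f _ z cf d0).
  + exact: cts_cst.
  + by move=> x; have := fm (x, z); lra.
- move=> f g M N cf cg [h1 ch1 hM] [h2 ch2 hN].
  exists (fun z => h1 z + h2 z); first exact: ctsD.
  move=> z; apply: le_trans (lerD (hM z) (hN z)); rewrite /A.
  rewrite -(stateD salpha (cA f h1 z cf ch1) (cA g h2 z cg ch2)) le_eqVlt.
  by apply/orP; left; apply/eqP; apply: eq_Rintegral => x _; ring.
- move=> a f M a0 cf [h ch hM]; exists (fun z => a * h z); first exact: ctsZ.
  move=> z; have := hM z; rewrite -(ler_pM2l a0); apply: le_trans.
  rewrite /A -(stateZ salpha a (cA f h z cf ch)) le_eqVlt.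
  by apply/orP; left; apply/eqP; apply: eq_Rintegral => x _; ring.
exists pi.
  have spi := Rintegral_state cK pi.
  have le h : cts Z R h -> \int[pi]_p h (tau p.1 p.2) <= \int[pi]_p h p.2.
    move=> ch; rewrite -subr_le0 -(stateB spi (cts_tau ch) (cts_snd ch)).
    apply: piS; first by apply: ctsB; [exact: cts_tau|exact: cts_snd].
    (* The choice [- h] cancels the coboundary being integrated. *)
    exists (fun z => - h z); first exact: ctsN.
    move=> z; rewrite /A -[leRHS](state_cst salpha) le_eqVlt.
    by apply/orP; left; apply/eqP; apply: eq_Rintegral => x _ /=; ring.
  apply/holonomicP => h ch; apply/eqP; rewrite eq_le le//=.
  have := le _ (ctsN ch).
  by rewrite (stateN spi (cts_tau ch)) (stateN spi (cts_snd ch)) lerN2.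
apply: entropy_ge => b nb; rewrite oppr0; apply: piS.
  exact: (is_lipschitz_cts nb.1).
exists (fun=> 0); first exact: cts_cst.
move=> z; apply: le_trans (normalized_int_le0 z nb).
rewrite le_eqVlt; apply/orP; left; apply/eqP.
by apply: eq_Rintegral => x _; rewrite addr0 subr0.
Qed.

End holonomic_entropy.

(** * Convexity of the pressure and duality *)

Section pressure_duality.
Context {R : realType} {X Z : pmetricType R}.
Hypotheses (cX : compact [set: X]) (cZ : compact [set: Z]).
Variables (tau : X -> Z -> Z) (tau_contr : uniformly_contractive tau).
Variable alpha : borel_probability X R.
Implicit Types (f g b k : X * Z -> R) (h : Z -> R).
Implicit Types (pi : borel_probability (X * Z)%type R).

Let K := (X * Z)%type : ptopologicalType.
Let cK : compact [set: X * Z] := compact_prod cX cZ.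
Let H pi := entropy tau alpha pi.
Let P k := pressure tau alpha k.

Lemma pressure_ub pi k : cts K R k -> holonomic tau pi ->
  ((\int[pi]_p k p)%:E + H pi <= P k)%E.
Proof.
move=> ck hpi; rewrite -(integralE_Rintegral cK pi ck).
by apply: ereal_sup_ubound; exists pi.
Qed.

(** Since entropy is at most [0], it is real or [-oo]; in the latter case the term is [-oo], so only
    real entropies have to be checked. *)
Lemma pressure_le k v : cts K R k ->
  (forall pi e, holonomic tau pi -> H pi = e%:E -> \int[pi]_p k p + e <= v) ->
  (P k <= v%:E)%E.
Proof.
move=> ck Hv; apply: ge_ereal_sup => _ [pi hpi <-].
rewrite (integralE_Rintegral cK pi ck) -/(H pi).
have := entropy_le0 cX cZ tau alpha pi; rewrite -/(H pi).
have := Hv pi; case: (H pi) => [e| |] // He _; last by rewrite addeC leNye.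
by rewrite -EFinD lee_fin He.
Qed.

Lemma pressure_fin k : cts K R k -> P k \is a fin_num.
Proof.
move=> ck; have [B [B0 kB]] := cts_bounded cK ck.
have kB' x : - B <= k x <= B by rewrite -ler_norml.
rewrite fin_numE; apply/andP; split.
  have [pi hpi Hpi] := exists_holonomic_entropy_ge0 cX cZ tau_contr alpha.
  have := pressure_ub ck hpi; rewrite -/(H pi) in Hpi *.
  apply: contraTneq => ->; rewrite leeNy_eq adde_eq_ninfty negb_or/=.
  by move: Hpi; rewrite -/(H pi); case: (H pi).
have PB : (P k <= B%:E)%E.
  apply: pressure_le => // pi e hpi He.
  have := entropy_le0 cX cZ tau alpha pi; rewrite -/(H pi) He lee_fin => e0.
  have spi := Rintegral_state cK pi.
  have : \int[pi]_p k p <= B.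
    rewrite -[leRHS](state_cst spi); apply: (state_le spi) => //; first exact: cts_cst.
    by move=> x; have /andP[] := kB' x.
  by lra.
by apply: contraTneq PB => ->; rewrite leye_eq.
Qed.

Definition real_pressure k := fine (P k).
Local Notation pr := real_pressure.

Lemma pressureE k : cts K R k -> P k = (pr k)%:E.
Proof. by move=> ck; rewrite fineK// pressure_fin. Qed.

Lemma real_pressure_ub pi e k : cts K R k -> holonomic tau pi -> H pi = e%:E ->
  \int[pi]_p k p + e <= pr k.
Proof.
by move=> ck hpi He; have := pressure_ub ck hpi; rewrite He pressureE// -EFinD lee_fin.
Qed.

Lemma real_pressure_le k v : cts K R k ->
  (forall pi e, holonomic tau pi -> H pi = e%:E -> \int[pi]_p k p + e <= v) ->
  pr k <= v.
Proof. by move=> ck Hv; rewrite -lee_fin -pressureE//; exact: pressure_le. Qed.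

Lemma real_pressure_convex s t f g : cts K R f -> cts K R g -> 0 <= s -> 0 <= t ->
  s + t = 1 -> pr (fun p => s * f p + t * g p) <= s * pr f + t * pr g.
Proof.
move=> cf cg s0 t0 st; apply: real_pressure_le => [|pi e hpi He].
  by apply: ctsD; apply: ctsZ.
have spi := Rintegral_state cK pi.
rewrite (stateD spi (ctsZ s cf) (ctsZ t cg)) (stateZ spi s cf) (stateZ spi t cg).
have := real_pressure_ub cf hpi He; have := real_pressure_ub cg hpi He.
by move=> /(ler_wpM2l t0) ? /(ler_wpM2l s0) ?; nra.
Qed.

(** As integrals are compared under holonomic probabilities only, this covers at once monotonicity,
    translation by constants and invariance under coboundaries. *)
Lemma real_pressure_compare f g m : cts K R f -> cts K R g ->
  (forall pi, holonomic tau pi -> \int[pi]_p f p <= \int[pi]_p g p + m) ->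
  pr f <= pr g + m.
Proof.
move=> cf cg fg; apply: real_pressure_le => // pi e hpi He.
have := fg pi hpi; have := real_pressure_ub cg hpi He; lra.
Qed.

Lemma real_pressure_shift f m : cts K R f -> pr (fun p => f p - m) = pr f - m.
Proof.
move=> cf; have cm : cts K R (fun p => f p - m) by apply: ctsB => //; exact: cts_cst.
have E pi : \int[pi]_p (f p - m) = \int[pi]_p f p - m.
  have spi := Rintegral_state cK pi.
  by rewrite (stateB spi cf (cts_cst m)) (state_cst spi).
apply/eqP; rewrite eq_le real_pressure_compare//=; last by move=> pi _; rewrite E.
by rewrite lerBlDr; apply: real_pressure_compare => // pi _; rewrite E subrK.
Qed.

Lemma real_pressure_normalized b : normalized tau alpha b -> pr b <= 0.
Proof.
move=> nb; apply: real_pressure_le => [|pi e hpi He].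
  exact: (is_lipschitz_cts nb.1).
have := entropy_le cX cZ pi nb; rewrite -/(H pi) He lee_fin; lra.
Qed.

Variables (mu : borel_probability X R) (c : X * Z -> R).
Hypothesis cc : cts K R c.

Lemma pressure_weak_duality (phi : X -> R) pi : cts X R phi ->
  P (fun p => c p - phi p.1) = 0%E -> holonomic_marginal mu tau pi ->
  (\int[pi]_p (c p)%:E + H pi <= \int[mu]_x (phi x)%:E)%E.
Proof.
move=> cphi P0 [hpi mpi].
have cphi1 : cts K R (fun p => phi p.1) by exact: cts_fst.
have := pressure_ub (ctsB cc cphi1) hpi; rewrite P0.
have spi := Rintegral_state cK pi.
rewrite (stateB spi cc cphi1) ((has_XmarginalP cX cZ mu pi).1 mpi _ cphi).
rewrite (integralE_Rintegral cK pi cc) (integralE_Rintegral cX mu cphi).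
case: (H pi) => [e| |] //; last by move=> _; rewrite addeC leNye.
by rewrite -!EFinD !lee_fin; lra.
Qed.

(** The convex [pr] is made sublinear around [c] by taking, over [t > 0] and [phi], the infimum of
    [pr (c + t f + phi) - V - \int phi dmu] divided by [t]. The hypothesis on [V] says that this is
    nonnegative at [f = 0]. *)
Lemma pressure_strong_duality V :
  (forall phi, cts X R phi -> V <= pr (fun p => c p - phi p.1) + \int[mu]_x phi x) ->
  exists2 pi, holonomic_marginal mu tau pi &
    (V%:E <= \int[pi]_p (c p)%:E + H pi)%E.
Proof.
move=> HV.
have smu := Rintegral_state cX mu.
pose G t f phi := fun p : X * Z => c p + t * f p + phi p.1.
have cG t f phi : cts K R f -> cts X R phi -> cts K R (G t f phi).
  by move=> cf cphi; apply: ctsD; [apply: ctsD => //; exact: ctsZ|exact: cts_fst].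
pose S f M := exists t, 0 < t /\ exists2 phi, cts X R phi &
  pr (G t f phi) - V - \int[mu]_x phi x <= t * M.
have d0 : cts X R (fun=> 0) by exact: cts_cst.
(* The offset [pr c - V] becomes negligible after division by a large [t]; the chosen [t] makes
   [t * e] exceed it. *)
have SE (phi : R -> X -> R) f m e : cts K R f -> (forall t, cts X R (phi t)) ->
    (forall t, 0 < t -> pr (G t f (phi t)) - \int[mu]_x phi t x <= pr c + t * m) ->
    0 < e -> S f (m + e).
  move=> cf cphi Ht e0; pose t := (`|pr c - V| + 1) / e.
  have t0 : 0 < t by rewrite divr_gt0// ltr_wpDl.
  exists t; split=> //; exists (phi t) => //.
  have te : t * e = `|pr c - V| + 1 by rewrite /t mulfVK// gt_eqF.
  rewrite mulrDr te; have := Ht t t0; have := ler_norm (pr c - V); lra.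
have [| | | |pi piS] := @dominated_probability R K (@pseudometric_cozero R (X * Z)%type) cK S.
- move=> M [t [t0 [phi cphi tM]]].
  rewrite -(pmulr_rge0 _ t0); apply: le_trans tM.
  have := HV (fun x => - phi x) (ctsN cphi); rewrite (stateN smu cphi).
  rewrite (_ : G t _ _ = fun p => c p - - phi p.1); first lra.
  by apply/funext => p; rewrite /G mulr0 addr0 opprK.
- move=> f m e cf fm e0; apply: (SE (fun _ _ => 0)) => // t t0.
  rewrite (state_cst smu) subr0; apply: real_pressure_compare => //; first exact: cG.
  move=> pi _; have spi := Rintegral_state cK pi.
  rewrite -[t * m](state_cst spi) -(stateD spi cc (cts_cst _)).
  apply: (state_le spi); [exact: cG|by apply: ctsD => //; exact: cts_cst|].
  by move=> x; rewrite /G addr0 lerD2l ler_pM2l.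
- move=> f g M N cf cg [t [t0 [phi cphi tM]]] [u [u0 [psi cpsi uN]]].
  have tu0 : 0 < t + u by rewrite addr_gt0.
  (* These convex weights satisfy [a * t = d * u], so the combination of the two perturbed
     potentials has the common factor [a * t] in front of [f + g]. *)
  pose a := u / (t + u); pose d := t / (t + u).
  have a0 : 0 <= a by rewrite divr_ge0// ltW.
  have d0' : 0 <= d by rewrite divr_ge0// ltW.
  have ad : a + d = 1 by rewrite -mulrDl [u + t]addrC divff// gt_eqF.
  exists (a * t); split; first by rewrite mulr_gt0// divr_gt0.
  exists (fun x => a * phi x + d * psi x); first by apply: ctsD; exact: ctsZ.
  rewrite (stateD smu (ctsZ a cphi) (ctsZ d cpsi)) (stateZ smu a cphi) (stateZ smu d cpsi).
  have GE : G (a * t) (fun x => f x + g x) (fun x => a * phi x + d * psi x) =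
      (fun p => a * G t f phi p + d * G u g psi p).
    apply/funext => p; rewrite /G /a /d; field.
    by rewrite gt_eqF.
  rewrite GE; have := real_pressure_convex (cG t f phi cf cphi) (cG u g psi cg cpsi) a0 d0' ad.
  have atdu : a * t = d * u by rewrite /a /d; ring.
  have := ler_wpM2l a0 tM; have := ler_wpM2l d0' uN.
  have -> : a * t * (M + N) = a * (t * M) + d * (u * N) by rewrite mulrDr {2}atdu; ring.
  by nra.
- move=> a f M a0 cf [t [t0 [phi cphi tM]]].
  exists (t / a); split; first by rewrite divr_gt0.
  exists phi => //; rewrite (_ : G _ _ _ = G t f phi).
    by rewrite mulrA divfK// gt_eqF.
  by apply/funext => p; rewrite /G mulrA divfK// gt_eqF.
have spi := Rintegral_state cK pi.
have piSE (phi : R -> X -> R) f m : cts K R f -> (forall t, cts X R (phi t)) ->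
    (forall t, 0 < t -> pr (G t f (phi t)) - \int[mu]_x phi t x <= pr c + t * m) ->
    \int[pi]_p f p <= m.
  move=> cf cphi Ht; apply/ler_addgt0Pr => e e0; apply: piS => //; exact: (SE phi).
have hpi : holonomic tau pi.
  (* Adding any multiple of a coboundary leaves the pressure unchanged, so its integral is at most
     [0]. *)
  have le h : cts Z R h -> \int[pi]_p h (tau p.1 p.2) <= \int[pi]_p h p.2.
    move=> ch; have ctau := cts_tau tau_contr ch; have csnd := @cts_snd _ X _ _ ch.
    rewrite -subr_le0 -(stateB spi ctau csnd).
    apply: (piSE (fun _ _ => 0)) => //; first exact: ctsB.
    move=> t t0; rewrite (state_cst smu) subr0; apply: real_pressure_compare => //.
      by apply: cG => //; exact: ctsB.
    move=> nu hnu; have snu := Rintegral_state cK nu.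
    rewrite /G mulr0 addr0 (stateD snu) ?(state_cst snu) ?addr0; last exact: cts_cst.
      rewrite (stateD snu cc (ctsZ t (ctsB ctau csnd))) (stateZ snu t (ctsB ctau csnd)).
      rewrite (stateB snu ctau csnd) (holonomicP cX cZ tau_contr nu).1//.
      by rewrite subrr mulr0 addr0.
    by apply: ctsD => //; apply: ctsZ; exact: ctsB.
  apply/(holonomicP cX cZ tau_contr) => h ch; apply/eqP; rewrite eq_le le//=.
  have := le _ (ctsN ch).
  by rewrite (stateN spi (cts_tau tau_contr ch)) (stateN spi (@cts_snd _ X _ _ ch)) lerN2.
have mpi : has_Xmarginal mu pi.
  have le phi : cts X R phi -> \int[pi]_p phi p.1 <= \int[mu]_x phi x.
    (* The correction [- t * phi] cancels the perturbation, leaving [pr c] and the term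
       [t * \int phi dmu]. *)
    move=> cphi; apply: (piSE (fun t x => - t * phi x)); [exact: cts_fst|by move=> t; exact: ctsZ|].
    move=> t t0; rewrite (stateZ smu (- t) cphi).
    rewrite (_ : G _ _ _ = c); first lra.
    by apply/funext => p; rewrite /G; ring.
  apply/(has_XmarginalP cX cZ) => phi cphi; apply/eqP; rewrite eq_le le//=.
  have := le _ (ctsN cphi).
  by rewrite (stateN spi (@cts_fst _ _ Z _ cphi)) (stateN smu cphi) lerN2.
exists pi => //.
rewrite (integralE_Rintegral cK pi cc) addeC -leeBlDr// -EFinB.
apply: entropy_ge => // b nb.
have cb : cts K R b := is_lipschitz_cts nb.1.
(* In the direction [b - c] with [t = 1] the perturbed potential is [b], whose pressure is at most
   [0]. *)
have : \int[pi]_p (b p - c p) <= - V.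
  apply: piS; first exact: ctsB.
  exists 1; split=> //; exists (fun=> 0) => //.
  rewrite (state_cst smu) subr0 mul1r.
  rewrite (_ : G _ _ _ = b); first by have := real_pressure_normalized nb; lra.
  by apply/funext => p; rewrite /G; ring.
rewrite (stateB spi cb cc); lra.
Qed.

End pressure_duality.

(** * Equality of the constrained infimum and the entropy supremum *)

Local Open Scope ereal_scope.

Theorem corollary22 (R : realType) (X Z : pmetricType R)
    (X_compact : compact [set: X]) (Z_compact : compact [set: Z])
    (tau : X -> Z -> Z) (tau_contr : uniformly_contractive tau)
    (alpha : borel_probability X R) (alpha_supp : full_support alpha)
    (mu : borel_probability X R)
    (c : X * Z -> R) (c_cont : continuous c) :
  ereal_inf [set \int[mu]_x (phi x)%:E |
    phi in [set phi : X -> R | continuous phi /\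
      pressure tau alpha (fun p => c p - phi p.1)%R = 0]] =
  ereal_sup [set \int[pi]_p (c p)%:E + entropy tau alpha pi |
    pi in holonomic_marginal mu tau].
Proof.
have cK := compact_prod X_compact Z_compact.
apply/eqP; rewrite eq_le; apply/andP; split; last first.
  apply: ge_ereal_sup => _ [pi hpi <-]; apply: le_ereal_inf_tmp => _ [phi [cphi P0] <-].
  exact: (pressure_weak_duality X_compact Z_compact (mu := mu) c_cont cphi P0 hpi).
set V := ereal_inf _; set W := ereal_sup _.
pose pr k := real_pressure tau alpha k.
(* For any [phi], adding the constant [v = pr (c - phi)] makes it admissible and raises its integral
   by [v]; this removes the pressure constraint. *)
have VE phi : continuous phi ->
    (V <= (pr (fun p => c p - phi p.1)%R + \int[mu]_x phi x)%:E).
  move=> cphi; set v := pr _.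
  have cphi1 : cts (X * Z)%type R (fun p => phi p.1) by exact: cts_fst.
  have cpsi : continuous (fun x => phi x + v)%R by apply: ctsD => //; exact: cts_cst.
  have smu := Rintegral_state X_compact mu.
  rewrite addrC -[v in (_ + v)%R](state_cst smu) -(stateD smu cphi (cts_cst v)).
  rewrite -(integralE_Rintegral X_compact mu cpsi).
  apply: ereal_inf_lbound; exists (fun x => phi x + v)%R => //; split=> //.
  rewrite (_ : (fun p => _) = (fun p => c p - phi p.1 - v)%R); last first.
    by apply/funext => p; rewrite opprD addrA.
  rewrite (pressureE X_compact Z_compact tau_contr); last first.
    by apply: ctsB; [exact: ctsB|exact: cts_cst].
  rewrite (real_pressure_shift X_compact Z_compact tau_contr); last exact: ctsB.
  by rewrite subrr.
(* The bound at [phi = 0] is real, which excludes [+oo]; the value [-oo] makes the inequality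
   trivial. *)
have : V != +oo.
  by apply: contraTneq (VE (fun=> 0%R) (cts_cst _)) => ->; rewrite leye_eq.
move: VE; case: V => [v| |] VE // _; last by rewrite leNye.
have [|pi hpi piV] := @pressure_strong_duality _ _ _ X_compact Z_compact tau
    tau_contr alpha mu c c_cont v.
  by move=> phi cphi; rewrite -lee_fin; exact: VE.
by apply: le_trans piV _; apply: ereal_sup_ubound; exists pi.
Qed.
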